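(* Let $\mathcal{L}$ be a finite set of distinct positive integers, exactly $c$ of which are even. Then $f_{\mathcal{L}}(n)=O(n^c)$ as $n\to\infty$.
   Context: For a set $\mathcal{L}$ of positive integers, $f_{\mathcal{L}}(n)$ denotes the maximum number of vectors in $\{0,1\}^n$ such that the Hamming distance between any two distinct ones lies in $\mathcal{L}$. The Hamming distance between two vectors is the number of coordinates in which they differ. *)

(* Defs.v *)
From mathcomp Require Import all_boot.

Set Implicit Arguments.
Unset Strict Implicit.
Unset Printing Implicit Defensive.

Definition hamming (n : nat) (x y : n.-tuple bool) : nat :=
  #|[pred i : 'I_n | tnth x i != tnth y i]|.

Definition distances_in (L : {pred nat}) (n : nat)
    (A : {set n.-tuple bool}) : bool :=
  [forall x in A, forall y in A, (x != y) ==> (hamming x y \in L)].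

Definition max_code (L : {pred nat}) (n : nat) : nat :=
  \max_(A : {set n.-tuple bool} | distances_in L A) #|A|.

(* Main.v *)
Require Import Defs.
(* MathComp / MathComp-Analysis *)
From mathcomp Require Import all_boot all_order all_algebra finmap.
From mathcomp Require Import all_classical all_reals all_analysis.
Import Order.TTheory GRing.Theory Num.Theory.
Import numFieldNormedType.Exports.
Local Open Scope fset_scope.
Local Open Scope classical_set_scope.
Local Open Scope ring_scope.

(** The parity of the Hamming distance of x and y is the sum of the parities of
their weights, so a code splits into two classes inside which only the c even
distances occur. For x, y in one class A, the product of d(x, y) - l over the
even l in L vanishes exactly when x <> y, hence these products form an
invertible diagonal matrix of size |A|. In terms of +1/-1 vectors,
2 (d(x, y) - l) = (n - 2 l) - <x, y> is a sum of n + 1 terms of the form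
u(x) v(y); expanding the product shows that the matrix has rank at most
(n + 1)^c, so that |A| <= (n + 1)^c. *)

(** Expanding the product gives one term per function [f : I -> J], each a function of x times a
    function of y, so the matrix of products over [A] factors through dimension [#|J| ^ #|I|]. *)
Lemma leq_card_separated_prod (F : fieldType) (T I J : finType) (A : {set T})
    (u v : I -> J -> T -> F) :
  (forall x y, x \in A -> y \in A ->
    (\prod_i \sum_j u i j x * v i j y == 0) = (x != y)) ->
  (#|A| <= #|J| ^ #|I|)%N.
Proof.
move=> uv0; rewrite -card_ffun.
pose p (f : {ffun I -> J}) x : F := \prod_i u i (f i) x.
pose q (f : {ffun I -> J}) y : F := \prod_i v i (f i) y.
pose P := \matrix_(a < #|A|, f < #|{ffun I -> J}|)
  p (enum_val f) (enum_val a).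
pose Q := \matrix_(f < #|{ffun I -> J}|, b < #|A|)
  q (enum_val f) (enum_val b).
have PQE a b : (P *m Q) a b =
    \prod_i \sum_j u i j (enum_val a) * v i j (enum_val b).
  rewrite mxE bigA_distr_bigA [RHS](reindex_onto enum_val enum_rank) /=; last first.
    by move=> f _; rewrite enum_rankK.
  apply: eq_big => [f|f _]; first by rewrite enum_valK eqxx.
  by rewrite !mxE -big_split.
have PQ_diag : P *m Q = diag_mx (\row_a (P *m Q) a a).
  apply/matrixP => a b; rewrite [RHS]mxE [in RHS]mxE.
  have [->|ab] := eqVneq a b; first by rewrite mulr1n.
  rewrite mulr0n; apply/eqP; rewrite PQE uv0 ?enum_valP//.
  by rewrite (inj_eq enum_val_inj).
have PQ_unit : P *m Q \in unitmx.
  rewrite PQ_diag unitmxE det_diag unitfE.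
  apply/prodf_neq0 => a _.
  by rewrite mxE PQE uv0 ?enum_valP// eqxx.
rewrite -(mxrank_unit PQ_unit).
exact: leq_trans (mxrankM_maxl P Q) (rank_leq_col P).
Qed.

Lemma hammingE n (x y : n.-tuple bool) :
  hamming x y = (\sum_i (tnth x i (+) tnth y i))%N.
Proof.
rewrite /hamming -sum1_card big_mkcond /=.
by apply: eq_bigr => i _; rewrite inE; case: (tnth x i); case: (tnth y i).
Qed.

Lemma odd_hamming n (x y : n.-tuple bool) :
  odd (hamming x y) =
  odd (\sum_i tnth x i)%N (+) odd (\sum_i tnth y i)%N.
Proof.
rewrite hammingE !(big_morph odd oddD (erefl _)) -big_split /=.
by apply: eq_bigr => i _; rewrite !oddb.
Qed.

Lemma hamming_eq0 n (x y : n.-tuple bool) : (hamming x y == 0)%N = (x == y).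
Proof.
apply/idP/eqP => [/eqP/card0_eq xy|->]; last first.
  by rewrite /hamming eq_card0// => i; rewrite !inE eqxx.
apply: eq_from_tnth => i; apply/eqP.
by have := xy i; rewrite !inE => /negbFE.
Qed.

(** Each coordinate contributes 1 minus a sign, that is 0 or 2; doubling the distance avoids a
    division. *)
Lemma hamming_sign (R : pzRingType) n (x y : n.-tuple bool) :
  (hamming x y)%:R *+ 2 =
  n%:R - \sum_i (-1) ^+ tnth x i * (-1) ^+ tnth y i :> R.
Proof.
rewrite hammingE natr_sum -sumrMnl.
have -> : n%:R = \sum_(i < n) 1 :> R by rewrite sumr_const card_ord.
rewrite -sumrB; apply: eq_bigr => i _; rewrite -signr_addb.
by case: (_ (+) _); rewrite ?expr1 ?opprK ?expr0 ?subrr ?mul0rn.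
Qed.

Lemma card_distances_in_le (E : {fset nat}) n (A : {set n.-tuple bool}) :
  (forall l, l \in E -> (0 < l)%N) -> distances_in (mem E) A ->
  (#|A| <= n.+1 ^ #|` E|)%N.
Proof.
move=> E_gt0 /forall_inP AE.
(* The index type [unit + 'I_n] has n + 1 elements: [inl tt] carries the constant n - 2 l, the
   others the coordinates. As [rat] has characteristic 0, a factor vanishes only if the distance is
   exactly l. *)
pose u (l : E) (j : unit + 'I_n) (x : n.-tuple bool) : rat :=
  if j is inr i then - (-1) ^+ tnth x i else n%:R - (val l)%:R *+ 2.
pose v (l : E) (j : unit + 'I_n) (y : n.-tuple bool) : rat :=
  if j is inr i then (-1) ^+ tnth y i else 1.
have uvE l x y : \sum_j u l j x * v l j y =
    ((hamming x y)%:R - (val l)%:R) *+ 2.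
  rewrite big_sumType /= (big_pred1 tt) => [|[]//]; rewrite mulr1 mulrnBl hamming_sign.
  under eq_bigr do rewrite mulNr.
  by rewrite sumrN addrAC.
rewrite cardfE -add1n -card_unit -[n in (_ + n)%N]card_ord -card_sum.
apply: (@leq_card_separated_prod _ _ _ _ _ u v) => x y xA yA.
have factor0 l : (\sum_j u l j x * v l j y == 0) = (hamming x y == val l).
  by rewrite uvE mulrn_eq0 /= subr_eq0 eqr_nat.
(* A vanishing factor makes the distance some l > 0, which excludes x = y. *)
apply/prodf_eq0/idP => [[l _]|xy].
  rewrite factor0 => /eqP dl; rewrite -hamming_eq0 dl -lt0n.
  exact: E_gt0 (valP l).
have /forall_inP/(_ y yA)/implyP/(_ xy) dE := AE x xA.
by exists [` dE ] => //; rewrite factor0.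
Qed.

Lemma max_code_le (L : {fset nat}) n :
  (forall l, l \in L -> (0 < l)%N) ->
  (max_code (mem L) n <= 2 * n.+1 ^ #|` [fset l in L | ~~ odd l]|)%N.
Proof.
move=> L_gt0; apply/bigmax_leqP => A /forall_inP AL.
(* Inside [B], and inside its complement, all distances are even; these two classes give the factor
   2. *)
pose B := [set x : n.-tuple bool | odd (\sum_i tnth x i)%N]%SET.
have class_le (C : {set n.-tuple bool}) : C \subset A ->
    {in C &, forall x y, (x \in B) = (y \in B)} ->
    (#|C| <= n.+1 ^ #|` [fset l in L | ~~ odd l]|)%N.
  move=> /fintype.subsetP CA CB; apply: card_distances_in_le => [l|].
    by rewrite !inE => /andP[/L_gt0].
  apply/forall_inP => x xC; apply/forall_inP => y yC; apply/implyP => xy.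
  have /forall_inP/(_ y (CA y yC))/implyP/(_ xy) dL := AL x (CA x xC).
  have := CB x y xC yC; rewrite !inE => oddxy.
  by rewrite odd_hamming oddxy addbb andbT; exact: dL.
rewrite -(cardsID B A) mul2n -addnn leq_add//; apply: class_le.
- exact: finset.subsetIl.
- by move=> x y /finset.setIP[_ ->] /finset.setIP[_ ->].
- exact: finset.subsetDl.
- by move=> x y /finset.setDP[_ /negPf->] /finset.setDP[_ /negPf->].
Qed.

Theorem theorem7 (R : realType) (L : {fset nat}) (c : nat)
    (L_gt0 : forall l : nat, l \in L -> (0 < l)%N)
    (L_even : #|` [fset l in L | ~~ odd l] | = c) :
  (fun n : nat => (max_code (mem L) n)%:R : R) =O_\oo
  (fun n : nat => (n%:R : R) ^+ c).
Proof.
(* The factor [2 ^ c] pays for n + 1 <= 2 n, valid once n > 0. *)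
apply/eqO_exP; exists (2 * 2 ^ c)%:R; first by rewrite ltr0n muln_gt0 expn_gt0.
near=> n.
have n_gt0 : (0 < n)%N by near: n; exact: nbhs_infty_gt.
rewrite normrX !normr_nat -natrX -natrM ler_nat -mulnA -expnMn.
apply: leq_trans (max_code_le L n L_gt0) _; rewrite L_even leq_mul2l /=.
(* The case c = 0 is separate because [leq_exp2r] needs a positive exponent. *)
by case: (c) => // k; rewrite leq_exp2r// mul2n -addnn -addn1 leq_add2l.
Unshelve. all: by end_near.
Qed.
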